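(* Let $q$ be a prime power, $n\ge2$, let $r_1,r_2$ be positive divisors of $n$, and let $\alpha\in\mathbb{F}_{q^n}^*$. Consider in $\mathrm{PG}(1,q^n)$ \[L_{r_1}=\{\langle (x,\mathrm{Tr}_{q^n/q^{r_1}}(x))\rangle_{\mathbb{F}_{q^n}}\colon x\in\mathbb{F}_{q^n}^*\},\qquad \sigma(L_{r_2})=\{\langle (\alpha\,\mathrm{Tr}_{q^n/q^{r_2}}(y),y)\rangle_{\mathbb{F}_{q^n}}\colon y\in\mathbb{F}_{q^n}^*\}.\] If $\frac n2\ge r_1+r_2+1$, then $L_{r_1}\cap\sigma(L_{r_2})\neq\emptyset$.
   Context: For a divisor $r$ of $n$, $\mathrm{Tr}_{q^n/q^r}(x)=\sum_{i=0}^{n/r-1}x^{q^{ir}}$. $\sigma$ denotes the projectivity $\langle (X_0,X_1)\rangle_{\mathbb{F}_{q^n}}\mapsto\langle(X_1,X_0)\rangle_{\mathbb{F}_{q^n}}$ of $\mathrm{PG}(1,q^n)$. *)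

(* Defs.v *)
From HB Require Import structures.
From mathcomp Require Import all_boot all_order all_algebra all_field.
Set Implicit Arguments. Unset Strict Implicit. Unset Printing Implicit Defensive.
Import GRing.Theory.
Local Open Scope ring_scope.

Definition prime_power (q : nat) : Prop :=
  exists p k : nat, [/\ prime p, (0 < k)%N & q = (p ^ k)%N].

(* Relative trace Tr_{q^n/q^r}(x) = sum_{i=0}^{n/r-1} x^{q^{i r}},
   for F the field with q^n elements and r a divisor of n. *)
Definition relTr (F : fieldType) (q n r : nat) (x : F) : F :=
  \sum_(i < n %/ r) x ^+ (q ^ (i * r)).

Definition same_point (F : fieldType) (u v : F * F) : Prop :=
  exists2 l : F, l != 0 & u = (l * v.1, l * v.2).

Definition L_set (F : fieldType) (q n r : nat) (P : F * F) : Prop :=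
  exists2 x : F, x != 0 & same_point P (x, relTr q n r x).

Definition sigmaL_set (F : fieldType) (q n r : nat) (alpha : F) (P : F * F) : Prop :=
  exists2 y : F, y != 0 & same_point P (alpha * relTr q n r y, y).

(* Main.v *)
(** A common point amounts to some [x != 0] with [Tr_1 x = 1] and
    [Tr_2 (alpha / x) = 1]; one may take [q = p] prime, [n = N], [r_i = s_i].
    Without such an [x], the function
    [(1 - (Tr_1 x - 1)^(p^s_1 - 1)) (1 - (Tr_2 (alpha / x) - 1)^(p^s_2 - 1))]
    vanishes on [F^*], and so do all its sums against monomials. It expands into
    monomials whose exponent is [sum_i u_i p^i - sum_i u'_i p^i], where [u], [u']
    have digit sum at most [s_1 (p-1)], [s_2 (p-1)]. If some exponent has only
    one such representation modulo [p^N - 1], its coefficient is a product of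
    multinomial coefficients prime to [p] and a power of [alpha], hence nonzero: a
    contradiction. Such an exponent is given by a signed digit string of minimal
    weight (for [p = 2], close to a non-adjacent form). Its average digit is at
    most about [(p-1)/2] in absolute value, and [2 (s_1 + s_2 + 1) <= N] leaves
    room for exactly such a string. *)
Require Import Defs.
From HB Require Import structures.
From mathcomp Require Import all_boot all_order all_algebra all_field.
From mathcomp Require Import fingroup cyclic mpoly zify ring.
Import Order.TTheory GRing.Theory Num.Theory.
Local Open Scope ring_scope.

(** * Signed digit expansions and their carries *)

Lemma eq_of_sum_le (N : nat) (f g : nat -> int) :
  (forall i, (i < N)%N -> f i <= g i) ->
  \sum_(0 <= i < N) g i <= \sum_(0 <= i < N) f i ->
  forall i, (i < N)%N -> f i = g i.
Proof.
elim: N => [//|N IH] le_fg; rewrite !big_nat_recr //= => le_sum i.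
have le_s : \sum_(0 <= i < N) f i <= \sum_(0 <= i < N) g i.
  rewrite !big_mkord; apply: ler_sum => j _; apply: le_fg.
  by apply: ltn_trans (ltn_ord j) _.
have le_N := le_fg N (ltnSn N).
rewrite ltnS leq_eqVlt => /orP[/eqP->|lt_iN].
  by apply/eqP; rewrite eq_le le_N -(lerD2l (\sum_(0 <= i < N) f i))
    (le_trans _ le_sum) // lerD2r.
apply: IH lt_iN => [j lt_jN|]; first by apply: le_fg; apply: ltnW.
by rewrite -(lerD2r (g N)) (le_trans le_sum) // lerD2l.
Qed.

(** [k i] is the carry entering place [i]. The value [sum_i c_i p^i] changes by [k 0 - p^N * k N], a
    multiple of [p^N - 1] for cyclic [k]. *)
Definition carry (p : nat) (c k : nat -> int) (i : nat) : int :=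
  c i + k i - p%:Z * k i.+1.

(* The alternative signed expansions of [sum_i c_i p^i] modulo [p^N - 1] are the
   [carry p c k] with [k] cyclic, see [cyclic_carry]. *)
Definition carry_rigid (p N : nat) (c : nat -> int) : Prop :=
  forall k : nat -> int, k N = k 0%N ->
  \sum_(0 <= i < N) `|carry p c k i| <= \sum_(0 <= i < N) `|c i| ->
  \sum_(0 <= i < N) `|carry p c k i| = \sum_(0 <= i < N) `|c i| /\
  forall i, (i < N)%N -> 0 <= k i.

(** Summed around the cycle, the potentials cancel and the local inequalities bound the old weight
    by the new one. The assumed converse turns each of them into an equality. *)
Lemma potential_tight (p N : nat) (c k : nat -> int) (phi : nat -> int -> int) :
  phi N (k N) = phi 0%N (k 0%N) ->
  (forall i, (i < N)%N ->
     phi i.+1 (k i.+1) + `|c i| <= phi i (k i) + `|carry p c k i|) ->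
  \sum_(0 <= i < N) `|carry p c k i| <= \sum_(0 <= i < N) `|c i| ->
  \sum_(0 <= i < N) `|carry p c k i| = \sum_(0 <= i < N) `|c i| /\
  forall i, (i < N)%N ->
    phi i.+1 (k i.+1) + `|c i| = phi i (k i) + `|carry p c k i|.
Proof.
move=> phiN le_phi le_sum.
have sum_phi : \sum_(0 <= i < N) phi i (k i) = \sum_(0 <= i < N) phi i.+1 (k i.+1).
  apply/eqP; rewrite eq_sym -subr_eq0 -sumrB.
  by rewrite (telescope_sumr (fun i => phi i (k i))) // phiN subrr.
split; last by apply: eq_of_sum_le => //; rewrite !big_split /= sum_phi lerD2l.
apply/eqP; rewrite eq_le le_sum -(lerD2l (\sum_(0 <= i < N) phi i (k i))) /=.
rewrite {1}sum_phi -!big_split /= !big_mkord; apply: ler_sum => i _.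
exact: le_phi.
Qed.

(** Since [p|x| >= |x| + p - 1] for [x != 0] and [2|c i| <= p - 1], the potential [|x|] satisfies
    the local inequality. *)
Lemma carry_rigid_odd (p N : nat) (c : nat -> int) :
  (1 < p)%N -> (0 < N)%N ->
  (forall i, `|c i| *+ 2 <= p%:Z - 1) ->
  (forall i, c i < 0 -> c i.+1 <= 0) ->
  c N.-1 = 0 -> carry_rigid p N c.
Proof.
move=> p_gt1 N_gt0 c_small c_step cN k kN le_sum.
(* Linear bounds on [p * x], a product that [lia] treats as an atom. *)
have pk (x : int) : x = 0 /\ p%:Z * x = 0 \/ 0 < x /\ p%:Z - 1 + x <= p%:Z * x
    \/ x < 0 /\ p%:Z * x <= - (p%:Z - 1) + x.
  have [x_lt0|x_gt0|->] := ltrgtP x 0; last by left; rewrite mulr0.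
    have : 0 <= (p%:Z - 1) * (- x - 1) by rewrite mulr_ge0; lia.
    by rewrite mulrBl mul1r !mulrBr mulr1 mulrN; lia.
  have : 0 <= (p%:Z - 1) * (x - 1) by rewrite mulr_ge0; lia.
  by rewrite mulrBl mul1r !mulrBr mulr1; lia.
have [sum_eq tight] : \sum_(0 <= i < N) `|carry p c k i| = \sum_(0 <= i < N) `|c i|
    /\ forall i, (i < N)%N -> `|k i.+1| + `|c i| = `|k i| + `|carry p c k i|.
  apply: (@potential_tight p N c k (fun _ x => `|x|)) => //; first by rewrite kN.
  move=> j _; rewrite /carry.
  by have := pk (k j.+1); have := c_small j; lia.
have kN0 : k N = 0.
  have lt_N1 : (N.-1 < N)%N by lia.
  have := tight _ lt_N1; rewrite /carry cN prednK //.
  by have := pk (k N); have := c_small N.-1; lia.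
have nneg j : (j <= N)%N -> 0 <= k (N - j)%N.
  elim: j => [|j IH] le_jN; first by rewrite subn0 kN0.
  have {IH} := IH (ltnW le_jN).
  case eq_i : (N - j.+1)%N => [|i]; first by rewrite -kN kN0.
  (* If [k i.+1 < 0], tightness at [i] forces [c i < 0], hence [c i.+1 <= 0]; as [k i.+2 >= 0],
     tightness then fails at [i.+1]. *)
  have -> : (N - j = i.+2)%N by lia.
  move=> k2.
  have := tight i ltac:(lia); have := tight i.+1 ltac:(lia); rewrite /carry.
  have := pk (k i.+1); have := pk (k i.+2); have := c_small i.
  by have := c_small i.+1; have := c_step i; lia.
by split=> // i lt_iN; rewrite -(subKn (ltnW lt_iN)); apply: nneg; lia.
Qed.

(** For [p = 2] a unit digit violates [2|c i| <= p - 1]; the zero that follows each nonzero digit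
    compensates. *)
Lemma carry_rigid_2 (N : nat) (c : nat -> int) :
  (1 < N)%N ->
  (forall i, `|c i| <= 1) ->
  (forall i, c i != 0 -> c i.+1 = 0) ->
  (forall i, c i < 0 -> c i.+2 <= 0) ->
  c N.-1 = 0 -> c N.-2 = 0 -> carry_rigid 2 N c.
Proof.
move=> N_gt1 c_small c_nadj c_step cN1 cN2 k kN le_sum.
(* Potential of the carry [x]: after a nonzero digit, a unit carry of the same
   sign is free. *)
pose phi i (x : int) : int :=
  if i is j.+1 then if c j == 0 then `|x| else `|x *+ 2 - c j| - 1 else `|x|.
have phiE i (x : int) :
    c i = 0 /\ phi i.+1 x = `|x| \/ c i != 0 /\ phi i.+1 x = `|x *+ 2 - c i| - 1.
  by rewrite /phi; case: eqP; [left|right].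
have [sum_eq tight] : \sum_(0 <= i < N) `|carry 2 c k i| = \sum_(0 <= i < N) `|c i|
    /\ forall i, (i < N)%N ->
    phi i.+1 (k i.+1) + `|c i| = phi i (k i) + `|carry 2 c k i|.
  apply: potential_tight => //.
    (* The last digit is zero, so [phi N] is the absolute value, like [phi 0]. *)
    by rewrite -(prednK (ltnW N_gt1)) /phi cN1 eqxx prednK // ?kN //; lia.
  move=> [|j] _; rewrite /carry.
    by have := c_small 0%N; have := phiE 0%N (k 1%N); rewrite /(phi 0%N); lia.
  have [cj|cj] := eqVneq (c j) 0.
    have := phiE j (k j.+1); rewrite cj.
    by have := c_small j.+1; have := phiE j.+1 (k j.+2); lia.
  have := phiE j.+1 (k j.+2); rewrite c_nadj //.
  by have := phiE j (k j.+1); have := c_small j; lia.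
(* With two final zeros, tightness at [N.-1] reads [|k N| = |k N.-1| + |k N.-1 - 2 * k N|], and the
   right side is at least [2|k N|]. *)
have kN0 : k N = 0.
  have := tight N.-1 ltac:(lia); rewrite /carry cN1.
  have -> : (N.-1 = N.-2.+1)%N by lia.
  have := phiE N.-2 (k N.-2.+1); have := phiE N.-1 (k N).
  have -> : (N.-2.+2 = N)%N by lia.
  have -> : (N.-1.+1 = N)%N by lia.
  by rewrite cN1 cN2; lia.
have k0 : k 0%N = 0 by rewrite -kN.
have stepN0 i : (i.+1 < N)%N -> c i != 0 ->
    k i.+2 = k i.+1 /\ (k i.+1 = 0 \/ k i.+1 = c i).
  move=> lt_iN ci_neq0; have ci1 := c_nadj i ci_neq0.
  have := tight i.+1 lt_iN; rewrite /carry ci1.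
  by have := phiE i (k i.+1); have := phiE i.+1 (k i.+2); have := c_small i; lia.
have step00 i : (i.+1 < N)%N -> c i = 0 -> c i.+1 = 0 -> k i.+2 = 0.
  move=> lt_iN ci ci1; have := tight i.+1 lt_iN; rewrite /carry ci1.
  by have := phiE i (k i.+1); have := phiE i.+1 (k i.+2); lia.
have nneg j : (j <= N)%N -> 0 <= k (N - j)%N.
  elim: j => [|j IH] le_jN; first by rewrite subn0 kN0.
  have {IH} := IH (ltnW le_jN).
  case eq_i : (N - j.+1)%N => [|[|i]]; first by rewrite k0.
    have -> : (N - j = 2)%N by lia.
    have [c0|/(stepN0 0%N ltac:(lia))] := eqVneq (c 0%N) 0; last by lia.
    have := tight 0%N ltac:(lia); have := phiE 0%N (k 1%N).
    by rewrite /carry /(phi 0%N) k0; lia.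
  have -> : (N - j = i.+3)%N by lia.
  move=> k3_ge0; have lt_iN : (i.+2 < N)%N by lia.
  have [c1|/(stepN0 i.+1 lt_iN)] := eqVneq (c i.+1) 0; last by lia.
  have [c0|] := eqVneq (c i) 0; first by rewrite step00 //; lia.
  (* A negative [k i.+2] would equal [c i], so [c i.+2 <= 0], and tightness at [i.+2] would fail
     because [k i.+3 >= 0]. *)
  move=> /(stepN0 i (ltnW lt_iN)) step; have := c_step i.
  have := tight i.+2 lt_iN; have := c_small i.+2; rewrite /carry.
  by have := phiE i.+1 (k i.+2); have := phiE i.+2 (k i.+3); lia.
by split=> // i lt_iN; rewrite -(subKn (ltnW lt_iN)); apply: nneg; lia.
Qed.

(** Solve [k j = v j + p * k j.+1] downwards from [k N = -K]; the hypothesis says that this ends at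
    [k 0 = -K]. *)
Lemma cyclic_carry (p N : nat) (v : nat -> int) (K : int) :
  \sum_(0 <= i < N) v i * (p ^ i)%:Z = K * ((p ^ N)%:Z - 1) ->
  exists2 k : nat -> int, k N = k 0%N &
    forall i, (i < N)%N -> v i = k i - p%:Z * k i.+1.
Proof.
move=> sum_v.
pose k j := \sum_(j <= i < N) v i * (p ^ (i - j))%:Z - K * (p ^ (N - j))%:Z.
exists k => [|i lt_iN].
  have -> : k 0%N = \sum_(0 <= i < N) v i * (p ^ i)%:Z - K * (p ^ N)%:Z.
    by rewrite /k subn0; congr (_ - _); apply: eq_bigr => i _; rewrite subn0.
  by rewrite /k big_geq // subnn expn0 sum_v mulrBr mulr1 sub0r addrAC subrr sub0r.
rewrite /k (big_ltn lt_iN) subnn expn0 mulr1 mulrBr mulr_sumr.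
have -> : \sum_(i.+1 <= j < N) p%:Z * (v j * (p ^ (j - i.+1))%:Z) =
    \sum_(i.+1 <= j < N) v j * (p ^ (j - i))%:Z.
  rewrite !big_nat; apply: eq_bigr => j /andP[lt_ij _].
  by rewrite (_ : (j - i = (j - i.+1).+1)%N) ?expnS; lia.
rewrite (_ : (N - i = (N - i.+1).+1)%N) ?expnS; last by lia.
by rewrite PoszM mulrCA -[X in X - _]addrA addrK.
Qed.

(** Rigidity forces the digit sums of [u], [u'] to equal those of [d], [d']. A cyclic carry changes
    the signed digit sum by [(1 - p) * sum k], so nonnegative carries must vanish; this is why
    [carry_rigid] only asks for their sign. *)
Lemma carry_rigid_unique (p N : nat) (d d' u u' : nat -> nat) :
  (1 < p)%N ->
  carry_rigid p N (fun i => (d i)%:Z - (d' i)%:Z) ->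
  (forall i, d i = 0%N \/ d' i = 0%N) ->
  (\sum_(0 <= i < N) u i <= \sum_(0 <= i < N) d i)%N ->
  (\sum_(0 <= i < N) u' i <= \sum_(0 <= i < N) d' i)%N ->
  (\sum_(0 <= i < N) u i * p ^ i + \sum_(0 <= i < N) d' i * p ^ i =
   \sum_(0 <= i < N) u' i * p ^ i + \sum_(0 <= i < N) d i * p ^ i
     %[mod (p ^ N).-1])%N ->
  forall i, (i < N)%N -> u i = d i /\ u' i = d' i.
Proof.
move=> p_gt1 rigid disj le_u le_u' cong.
have toZ (f : nat -> nat) :
    (\sum_(0 <= i < N) f i)%N%:Z = \sum_(0 <= i < N) (f i)%:Z.
  by rewrite (big_morph Posz PoszD (erefl 0%:Z)).
pose v i : int := ((u i)%:Z - (u' i)%:Z) - ((d i)%:Z - (d' i)%:Z).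
have pN_gt0 : (0 < p ^ N)%N by rewrite expn_gt0 ltnW.
have [K sum_v] : exists K, \sum_(0 <= i < N) v i * (p ^ i)%:Z = K * ((p ^ N)%:Z - 1).
  have -> : \sum_(0 <= i < N) v i * (p ^ i)%:Z =
    (\sum_(0 <= i < N) u i * p ^ i + \sum_(0 <= i < N) d' i * p ^ i)%N%:Z -
    (\sum_(0 <= i < N) u' i * p ^ i + \sum_(0 <= i < N) d i * p ^ i)%N%:Z.
    rewrite !PoszD !toZ opprD addrACA -!sumrB -big_split /=.
    by apply: eq_bigr => i _; rewrite /v !PoszM !mulrBl; lia.
  move: cong; move: (_ + _)%N (_ + _)%N => b a cong.
  exists ((a %/ (p ^ N).-1)%:Z - (b %/ (p ^ N).-1)%:Z).
  rewrite {1}(divn_eq a (p ^ N).-1) {1}(divn_eq b (p ^ N).-1) cong.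
  have -> : (p ^ N)%:Z - 1 = (p ^ N).-1%:Z by lia.
  by rewrite mulrBl !PoszD !PoszM opprD addrACA subrr addr0.
have [k kN vk] := cyclic_carry _ _ _ _ sum_v.
pose c i : int := (d i)%:Z - (d' i)%:Z.
have carryE i : (i < N)%N -> carry p c k i = (u i)%:Z - (u' i)%:Z.
  by move=> /vk; rewrite /carry /v /c; lia.
have sum_carry : \sum_(0 <= i < N) `|carry p c k i| <=
    \sum_(0 <= i < N) ((u i)%:Z + (u' i)%:Z).
  by rewrite !big_mkord; apply: ler_sum => i _; rewrite carryE //; lia.
have sum_c : \sum_(0 <= i < N) `|c i| = \sum_(0 <= i < N) ((d i)%:Z + (d' i)%:Z).
  by apply: eq_bigr => i _; rewrite /c; case: (disj i) => ->; lia.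
have le_uu' : \sum_(0 <= i < N) ((u i)%:Z + (u' i)%:Z) <= \sum_(0 <= i < N) `|c i|.
  by rewrite sum_c !big_split /= -!toZ lerD // lez_nat.
have [eq_sum k_ge0] := rigid k kN (le_trans sum_carry le_uu').
have sum_k : \sum_(0 <= i < N) v i = (1 - p%:Z) * \sum_(0 <= i < N) k i.
  have shift : \sum_(0 <= i < N) k i.+1 = \sum_(0 <= i < N) k i.
    apply/eqP; rewrite -subr_eq0 -sumrB (telescope_sumr k) // kN.
    by rewrite subrr.
  rewrite mulrBl mul1r -{2}shift mulr_sumr -sumrB !big_nat.
  by apply: eq_bigr => i /andP[_ /vk].
have k0 i : (i < N)%N -> 0 = k i.
  apply: eq_of_sum_le => //; rewrite [X in _ <= X]big1 //.
  have : \sum_(0 <= i < N) v i = 0.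
    have := le_uu'; rewrite -eq_sum => le_uu.
    move: sum_carry; rewrite eq_sum sum_c !big_split /=.
    rewrite /v !sumrN !sumrB -!toZ; move: le_u le_u'.
    by move: (\sum_(0 <= i < N) u i)%N (\sum_(0 <= i < N) u' i)%N
      (\sum_(0 <= i < N) d i)%N (\sum_(0 <= i < N) d' i)%N; lia.
  rewrite sum_k => /eqP; rewrite mulf_eq0 => /orP[|/eqP->//]; lia.
move=> i lt_iN.
(* Equality of weights makes [u] and [u'] disjoint, as [d] and [d'] are. *)
have tight : `|carry p c k i| = (u i)%:Z + (u' i)%:Z.
  move: i lt_iN; apply: eq_of_sum_le; last by rewrite eq_sum.
  by move=> i lt_iN; rewrite carryE //; lia.
have : v i = 0.
  have [lt_i1|] := ltnP i.+1 N; first by rewrite vk // -!k0 // mulr0.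
  move=> ge_i1; have eqN : i.+1 = N by lia.
  by rewrite vk // eqN kN -!k0 ?mulr0 //; lia.
by move: tight; rewrite carryE // /v; case: (disj i) => ->; lia.
Qed.

(** * Digit strings of minimal weight *)

(** Sliding the window by one trades [a] for [a + s], in the same class. The witness is chosen
    before [f], so that the induction can test it on the indicator of [a]. *)
Lemma sum_class_window (s a j : nat) : (j < s)%N ->
  exists2 l, (l %% s = j)%N &
    forall f : nat -> nat, (\sum_(a <= i < a + s | i %% s == j) f i = f l)%N.
Proof.
move=> lt_js; have s_gt0 : (0 < s)%N by apply: leq_ltn_trans lt_js.
elim: a => [|a [l l_j sum_l]].
  exists j => [|f]; first by rewrite modn_small.
  rewrite add0n big_mkord (eq_bigl (pred1 (Ordinal lt_js))) ?big_pred1_eq //.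
  by move=> i; rewrite /= modn_small // -val_eqE.
have step (f : nat -> nat) :
    ((if a %% s == j then f a else 0) + \sum_(a.+1 <= i < a + s | i %% s == j) f i
     = f l)%N.
  by rewrite -sum_l [RHS]big_ltn_cond; [case: ifP|lia].
exists (if a %% s == j then a + s else l)%N => [|f].
  by case: ifP => [/eqP|//]; rewrite modnDr.
rewrite addSn big_mkcond big_nat_recr /=; last by lia.
rewrite -big_mkcond modnDr.
case: ifP (step f) (step (fun i => (i == a)%N : nat)) => _ step_f step_a.
  have eq_la : l = a by move: step_a; rewrite eqxx; case: eqP.
  move: step_f; rewrite eq_la -[RHS]addn0 => /addnI.
  by rewrite /= => ->; rewrite add0n.
by rewrite -step_f addn0.
Qed.

Lemma sum_restrict_window (N a b : nat) (P : pred nat) (f : nat -> nat) :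
  (b <= N)%N ->
  (\sum_(0 <= l < N | P l) (if (a <= l < b)%N then f l else 0) =
   \sum_(a <= l < b | P l) f l)%N.
Proof.
move=> le_bN; rewrite -big_mkcondr (big_nat_widenl a 0) // (big_nat_widen _ b N) //.
by apply: eq_bigl => l; rewrite -andbA.
Qed.

(* These are the digits of the exponents of maximal digit sum that occur in
   [(Tr x - 1) ^ (p ^ s - 1)], see [mcoeff_class_forms_neq0]. *)
Definition full_digits (p N s : nat) (d : nat -> nat) : Prop :=
  forall j, (j < s)%N -> (\sum_(0 <= l < N | l %% s == j) d l)%N = p.-1.

(** Two full periods meet each class twice, and [2 * p./2 = p.-1] for odd [p]. *)
Lemma full_digits_block (p N s a : nat) :
  odd p -> (a + 2 * s <= N)%N ->
  full_digits p N s (fun l => if (a <= l < a + 2 * s)%N then p./2 else 0%N).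
Proof.
move=> odd_p le_N j lt_js; rewrite sum_restrict_window //.
rewrite (@big_cat_nat _ _ _ (a + s)) //=; [|lia|lia].
have -> : (a + 2 * s = a + s + s)%N by lia.
have [l1 _ ->] := sum_class_window s a j lt_js.
have [l2 _ ->] := sum_class_window s (a + s) j lt_js.
by lia.
Qed.

(** Each class must receive a single digit [1]. For odd [s], the two members of a class among [2s]
    consecutive places differ by [s], so exactly one is even. For even [s], a class has a fixed
    parity, and the two windows serve the even and the odd classes. *)
Lemma full_digits_alternating (N s e o : nat) :
  let x := (if odd s then 2 * s else s)%N in let y := (2 * s - x)%N in
  ~~ odd e -> odd o -> (e + x <= N)%N -> (o + y <= N)%N ->
  full_digits 2 N s (fun l =>
    (~~ odd l && (e <= l < e + x) : nat) + (odd l && (o <= l < o + y) : nat))%N.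
Proof.
move=> x y e_even o_odd le_xN le_yN j lt_js.
have andE (a b : bool) : (a && b : nat) = if b then a : nat else 0%N.
  by case: b; rewrite ?andbT ?andbF.
under eq_bigr do rewrite !andE.
rewrite big_split /= !sum_restrict_window //.
rewrite /y /x {x y le_xN le_yN}; case: ifP => odd_s.
  rewrite subnn addn0 [X in (_ + X)%N]big_geq // addn0.
  rewrite (@big_cat_nat _ _ _ (e + s)) //=; [|lia|lia].
  rewrite (big_addn e).
  have -> : (e + 2 * s - s = e + s)%N by lia.
  under [X in (_ + X)%N]eq_bigl do rewrite modnDr.
  rewrite -big_split /=.
  have [l _ ->] := sum_class_window s e j lt_js.
  by rewrite oddD odd_s; case: (odd l).
have -> : (2 * s - s = s)%N by lia.
have odd_mod l : (l %% s = j)%N -> odd l = odd j.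
  by move=> <-; rewrite {1}(divn_eq l s) oddD oddM odd_s andbF.
have [l1 /odd_mod l1j ->] := sum_class_window s e j lt_js.
have [l2 /odd_mod l2j ->] := sum_class_window s o j lt_js.
by rewrite l1j l2j; case: (odd j).
Qed.

Lemma exists_rigid_digits (p N s s' : nat) :
  prime p -> (0 < s)%N -> (2 * (s + s' + 1) <= N)%N ->
  exists d d' : nat -> nat,
    [/\ full_digits p N s d, full_digits p N s' d',
        forall i, d i = 0%N \/ d' i = 0%N &
        carry_rigid p N (fun i => (d i)%:Z - (d' i)%:Z)].
Proof.
move=> p_prime s_gt0 le_N; have p_gt1 := prime_gt1 p_prime.
have [p_2|odd_p] := even_prime p_prime; last first.
  (* [h, ..., h, -h, ..., -h, 0, ..., 0] with [h = (p-1)/2]; the final zeros keep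
     the negative block from meeting the positive one cyclically. *)
  exists (fun l => if (0 <= l < 0 + 2 * s)%N then p./2 else 0%N).
  exists (fun l => if (2 * s <= l < 2 * s + 2 * s')%N then p./2 else 0%N).
  split; [by apply: full_digits_block => //; lia|by apply: full_digits_block => //; lia| |].
    by move=> i; case: ifP => i_lt; [right; rewrite ifF //; lia|left].
  apply: carry_rigid_odd => //= [|i|i|]; first by lia.
  - by case: ifP; case: ifP; lia.
  - by case: ifP; case: ifP; case: ifP; case: ifP; lia.
  - by case: ifP; case: ifP; lia.
pose x := (if odd s then 2 * s else s)%N; pose y := (2 * s - x)%N.
pose x' := (if odd s' then 2 * s' else s')%N; pose y' := (2 * s' - x')%N.
have : ~~ odd x /\ ~~ odd x' by rewrite /x /x'; split; case: ifP; lia.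
have : (x <= 2 * s /\ x' <= 2 * s')%N by rewrite /x /x'; split; case: ifP; lia.
(* The last nonzero even place is [x + x' - 2]; starting the odd ones at [x + x' + 1] keeps nonzero
   digits nonadjacent. *)
move=> [le_x le_x'] [even_x even_x']; pose o := (x + x' + 1)%N.
(* [(+0)^a (-0)^b 0 (+0)^a' (-0)^b' 0 ... 0]: no digit [-] is followed at
   distance two by a [+], which excludes the rewriting [- 0 + -> + +]. *)
pose d l : nat := (~~ odd l && (0 <= l < 0 + x) + (odd l && (o <= l < o + y)))%N.
pose d' l : nat :=
  (~~ odd l && (x <= l < x + x') + (odd l && (o + y <= l < o + y + y')))%N.
exists d, d'; rewrite p_2; split.
- by apply: full_digits_alternating; rewrite -/x -/y /o; lia.
- by apply: full_digits_alternating; rewrite -/x' -/y' /o; lia.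
- by move=> i; rewrite /d /d' /o; case: (odd i) => /=; lia.
have yE : (x + y = 2 * s)%N by rewrite /y; lia.
have y'E : (x' + y' = 2 * s')%N by rewrite /y'; lia.
rewrite /d /d' /o; clearbody x y x' y'; clear d d' o.
apply: carry_rigid_2 => [|i|i|i||]; first by lia.
- by case: (odd i) => /=; lia.
- by rewrite /=; case: (odd i) => /=; lia.
- by rewrite /= negbK; case: (odd i) => /=; lia.
(* All nonzero digits lie below place [2 * (s + s')], which is at most [N - 2]. *)
- by case E: (odd _) => /=; lia.
- by case E: (odd _) => /=; lia.
Qed.

(** * Expansion of the trace indicator *)

Lemma mderiv_expn (n : nat) (R : comNzRingType) (i : 'I_n) (q : {mpoly R[n]}) (k : nat) :
  (q ^+ k)^`M(i) = (q ^+ k.-1 * q^`M(i)) *+ k.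
Proof.
elim: k => [|k IH]; first by rewrite expr0 mulr0n -mpolyC1 mderivC.
rewrite exprS mderivM IH mulrC mulrnAr mulrA -exprS.
by case: k {IH} => [|k]; rewrite ?mulr0n ?addr0 //= -mulrS.
Qed.

Lemma mderiv_prod_eq0 (n : nat) (R : comNzRingType) (i : 'I_n) (I : Type) (r : seq I)
    (P : pred I) (q : I -> {mpoly R[n]}) :
  (forall j, P j -> (q j)^`M(i) = 0) -> (\prod_(j <- r | P j) q j)^`M(i) = 0.
Proof.
move=> q'0; elim/big_ind: _ => [|p p' p0 p'0|//]; first by rewrite -mpolyC1 mderivC.
by rewrite mderivM p0 p'0 mul0r mulr0 addr0.
Qed.

(* Evaluating ['X_l] at [x ^ (p ^ l)] turns this into [(Tr x - 1) ^ (p ^ j)]. *)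
Definition class_form (F : fieldType) (N s j : nat) : {mpoly F[N]} :=
  \sum_(l < N | (l %% s == j)%N) 'X_l - 1.

(** Arbitrary exponents make the family stable under derivations, up to integer factors. *)
Definition class_forms (F : fieldType) (N s : nat) (k : 'I_s -> nat) : {mpoly F[N]} :=
  \prod_(j < s) class_form F N s j ^+ k j.

Lemma mderiv_class_form (F : fieldType) (N s j : nat) (l : 'I_N) :
  (class_form F N s j)^`M(l) = (l %% s == j)%N%:R.
Proof.
rewrite /class_form mderivB -[1 in X in _ - X]mpolyC1 mderivC subr0 raddf_sum /=.
have E (i : 'I_N) : ('X_i : {mpoly F[N]})^`M(l) = if i == l then 1 else 0.
  rewrite mderivX mnm1E; case: eqP => [->|_]; last by rewrite scale0r.
  rewrite scale1r (_ : (U_(l) - U_(l))%MM = 0%MM) ?mpolyX0 //.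
  by apply/mnmP => j0; rewrite mnmBE subnn mnm0E.
under eq_bigr do rewrite E.
rewrite -big_mkcondr /=; have [lj|/negPf lj] := boolP (l %% s == j)%N.
  rewrite (big_pred1 l) // => i /=.
  by have [->|_] := eqVneq i l; rewrite ?lj ?andbF.
by rewrite big_pred0 // => i; have [->|_] := eqVneq i l; rewrite ?lj ?andbF.
Qed.

(** Only the factor of the class of [l] involves ['X_l], and its base has derivative [1]. *)
Lemma mderiv_class_forms (F : fieldType) (N s : nat) (k : 'I_s -> nat) (l : 'I_N)
    (j0 : 'I_s) : (l %% s = j0)%N ->
  (class_forms F N s k)^`M(l) =
  class_forms F N s (fun j => k j - (j == j0))%N *+ k j0.
Proof.
move=> l_j0; rewrite /class_forms (bigD1 j0) //= mderivM mderiv_expn.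
rewrite mderiv_class_form l_j0 eqxx mulr1 mderiv_prod_eq0 ?mulr0 ?addr0; last first.
  move=> j neq_j; rewrite mderiv_expn mderiv_class_form l_j0.
  by rewrite eq_sym val_eqE (negPf neq_j) mulr0 mul0rn.
rewrite [in RHS](bigD1 j0) //= eqxx subn1 mulrnAl.
congr (_ * _ *+ _); apply: eq_bigr => j /negPf ->.
by rewrite subn0.
Qed.

(* Differentiating along the digits of [m] brings the monomial [m] down to a
   product of integers between [1] and [p - 1]. *)
Lemma mcoeff_class_forms_neq0 (F : fieldType) (p N s : nat) (k : 'I_s -> nat)
    (m : 'X_{1..N}) :
  (0 < s)%N -> p \in [pchar F] -> (forall j, k j < p)%N ->
  (forall j : 'I_s, \sum_(l < N | l %% s == j) m l = k j)%N ->
  (class_forms F N s k)@_m != 0.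
Proof.
move=> s_gt0 pcharF.
have [n] := ubnP (mdeg m); elim: n k m => // n IH k m; rewrite ltnS => le_mn lt_kp sum_m.
have [m0|] := eqVneq (mdeg m) 0%N.
  move/eqP: m0 sum_m; rewrite mdeg_eq0 => /eqP -> sum_m.
  rewrite /class_forms big1 ?mcoeff1 ?eqxx ?oner_neq0 // => j _.
  by rewrite -sum_m big1 ?expr0 // => l _; rewrite mnm0E.
rewrite mdegE sum_nat_eq0 negb_forall => /existsP[l]; rewrite /= -lt0n => ml_gt0.
pose j0 := Ordinal (ltn_pmod l s_gt0).
have le_Ul : (U_(l) <= m)%MM by rewrite lep1mP -lt0n.
have kj0 : (0 < k j0)%N.
  by rewrite -sum_m (bigD1 l) //= ltn_addr.
pose k' j := (k j - (j == j0))%N.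
have sum_m' (j : 'I_s) : (\sum_(i < N | i %% s == j) (m - U_(l))%MM i = k' j)%N.
  rewrite /k' -sum_m -[in RHS](submK le_Ul).
  under [in RHS]eq_bigr do rewrite mnmDE.
  rewrite big_split /= (_ : \sum_(i < N | i %% s == j) U_(l)%MM i = (j == j0))%N.
    by rewrite addnK.
  have mnm1_if (i : 'I_N) : (U_(l)%MM i = if i == l then 1 else 0)%N.
    by rewrite mnm1E eq_sym; case: eqP.
  under eq_bigr do rewrite mnm1_if.
  rewrite -big_mkcondr /= -val_eqE eq_sym /=.
  have [lj|/negPf lj] := boolP (l %% s == j)%N.
    rewrite (big_pred1 l) ?lj // => i /=.
    by have [->|_] := eqVneq i l; rewrite ?lj ?andbF.
  by rewrite big_pred0 ?lj // => i; have [->|_] := eqVneq i l; rewrite ?lj ?andbF.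
have le_mdeg : (mdeg (m - U_(l))%MM < n)%N.
  by rewrite -(submK le_Ul) mdegD mdeg1 addn1 in le_mn.
have lt_k'p j : (k' j < p)%N by apply: leq_ltn_trans (lt_kp j); apply: leq_subr.
have := IH _ _ le_mdeg lt_k'p sum_m'.
(* A zero coefficient at [m] would kill the one of the derivative at [m - U_(l)], which is [k j0]
   times that of the smaller product; and [0 < k j0 < p] is invertible in [F]. *)
apply: contraNneq => coef0.
have := mcoeff_deriv l (m - U_(l)) (class_forms F N s k).
rewrite submK // coef0 mul0rn (mderiv_class_forms _ _ _ _ _ j0) // mcoeffMn.
move/eqP; rewrite -mulr_natr mulf_eq0 => /orP[//|].
rewrite -(dvdn_pcharf pcharF) => /dvdn_leq; rewrite kj0 => /(_ isT).
by rewrite leqNgt lt_kp.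
Qed.

Lemma sum_residue_class (V : nmodType) (M s j : nat) (f : nat -> V) : (j < s)%N ->
  \sum_(l < M * s | (l %% s == j)%N) f l = \sum_(i < M) f (i * s + j)%N.
Proof.
move=> lt_js; have s_gt0 : (0 < s)%N by apply: leq_ltn_trans lt_js.
have lt_h (i : 'I_M) : (i * s + j < M * s)%N.
  have := ltn_ord i; rewrite -(leq_pmul2r s_gt0) mulSn; apply: leq_trans.
  by rewrite addnC ltn_add2r.
have lt_h' (l : 'I_(M * s)) : (l %/ s < M)%N by rewrite ltn_divLR.
rewrite (reindex_onto (fun i => Ordinal (lt_h i)) (fun l => Ordinal (lt_h' l))) /=.
  apply: eq_bigl => i; rewrite modnMDl modn_small // eqxx /= -val_eqE /=.
  by rewrite divnMDl // divn_small // addn0 eqxx.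
by move=> l /eqP l_j; apply: val_inj; rewrite /= -l_j -divn_eq.
Qed.

Lemma meval_class_form (F : fieldType) (p N s j : nat) (x : F) :
  p \in [pchar F] -> (s %| N)%N -> (j < s)%N ->
  (class_form F N s j).@[fun l => x ^+ (p ^ l)] = (relTr p N s x - 1) ^+ (p ^ j).
Proof.
move=> pcharF /dvdnP[M ->] lt_js; have s_gt0 : (0 < s)%N by apply: leq_ltn_trans lt_js.
have pnat_pj : [pchar F].-nat (p ^ j)%N.
  by rewrite (eq_pnat _ (pcharf_eq pcharF)) pnatX pnat_id ?(pcharf_prime pcharF).
have expD : {morph (fun y : F => y ^+ (p ^ j)) : y z / y + z}.
  by move=> y z; apply: exprDn_pchar.
rewrite /class_form mevalB meval1 raddf_sum /= expD exprNn_pchar // expr1n.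
congr (_ - _); rewrite /relTr mulnK //.
rewrite (big_morph _ expD (id1 := 0)); last first.
  by rewrite expr0n expn_eq0 -leqn0 leqNgt prime_gt0 ?(pcharf_prime pcharF).
under eq_bigr do rewrite mevalXU.
rewrite (sum_residue_class _ _ _ _ (fun l => x ^+ (p ^ l))) //.
by apply: eq_bigr => i _; rewrite -exprM expnD.
Qed.

(** The exponents combine through [p^s - 1 = (p - 1) * sum_(j < s) p^j]. *)
Lemma meval_class_forms (F : fieldType) (p N s : nat) (x : F) :
  p \in [pchar F] -> (s %| N)%N ->
  (class_forms F N s (fun _ => p.-1)).@[fun l => x ^+ (p ^ l)] =
  (relTr p N s x - 1) ^+ (p ^ s).-1.
Proof.
move=> pcharF dvd_sN; rewrite /class_forms rmorph_prod /=.
under eq_bigr => j _ do rewrite rmorphXn /= (meval_class_form _ p) // -exprM.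
rewrite prodrXr predn_exp big_distrr /=; congr (_ ^+ _).
by apply: eq_bigr => j _; rewrite mulnC.
Qed.

(** Class forms have degree at most one; this bounds the digit sums of all exponents that occur. *)
Lemma mdeg_msupp_class_forms (F : fieldType) (N s : nat) (k : 'I_s -> nat)
    (m : 'X_{1..N}) :
  m \in msupp (class_forms F N s k) -> (mdeg m <= \sum_(j < s) k j)%N.
Proof.
pose bounded n (q : {mpoly F[N]}) := forall m, m \in msupp q -> (mdeg m <= n)%N.
have bounded1 : bounded 0%N 1 by move=> m'; rewrite msupp1 inE => /eqP->; rewrite mdeg0.
have boundedM n n' q q' : bounded n q -> bounded n' q' -> bounded (n + n')%N (q * q').
  move=> bq bq' m' /msuppM_le /allpairsP[[m1 m2] /= [/bq le1 /bq' le2 ->]].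
  by rewrite mdegD leq_add.
have bounded_form j : bounded 1%N (class_form F N s j).
  move=> m' /msuppB_le; rewrite mem_cat msupp1 inE => /orP[|/eqP->]; last by rewrite mdeg0.
  move=> /msupp_sum_le /flattenP[r /mapP[l _ ->]]; rewrite msuppX inE => /eqP->.
  by rewrite mdeg1.
move: m; apply: (big_ind2 (fun q n => bounded n q)) => //= [q n q' n'|j _].
  exact: boundedM.
by elim: (k j) => [|i IH] //; rewrite exprS -add1n; apply: boundedM.
Qed.

(** * Sums over the units of a finite field *)

Lemma expf_card_pred (F : finFieldType) (x : F) : x != 0 -> x ^+ #|F|.-1 = 1.
Proof.
move=> x_neq0; apply: (mulfI x_neq0).
by rewrite -exprS prednK ?expf_card ?mulr1 // ltnW ?finNzRing_gt1.
Qed.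

Lemma natr_card_eq0 (F : finFieldType) : #|F|%:R = 0 :> F.
Proof.
have : \sum_(x : F) x = \sum_(x : F) (x + 1) by apply: reindex_inj (addIr 1).
by rewrite big_split /= sumr_const -[LHS]addr0 => /addrI.
Qed.

(** The two exponents encode the integer [a - b]. If it is nonzero modulo [#|F| - 1], scaling [x] by
    a generator [w] multiplies the sum by [w^(a - b) != 1]; otherwise the sum counts the units, and
    [#|F| - 1] is [-1] in [F]. *)
Lemma sum_unit_monomial (F : finFieldType) (a b : nat) :
  \sum_(x : F | x != 0) x ^+ a * x^-1 ^+ b = - (a == b %[mod #|F|.-1])%:R.
Proof.
have [/eqP eq_ab|neq_ab] := boolP (a == b %[mod #|F|.-1]).
  transitivity (\sum_(x : F | x != 0) (1 : F)).
    apply: eq_bigr => x x_neq0.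
    have expmod n (y : F) : y != 0 -> y ^+ n = y ^+ (n %% #|F|.-1).
      move=> y_neq0; rewrite {1}(divn_eq n #|F|.-1) exprD mulnC exprM.
      by rewrite expf_card_pred // expr1n mul1r.
    by rewrite expmod // eq_ab -expmod // exprVn divff // expf_neq0.
  rewrite sumr_const cardC1 -subn1 natrB; last by rewrite ltnW ?finNzRing_gt1.
  by rewrite natr_card_eq0 sub0r.
have [w genw] := cyclicP (field_unit_group_cyclic [set: {unit F}]%G).
have ord_w : #[w]%g = #|F|.-1 by rewrite orderE -genw card_finField_unit.
have w_neq0 : val w != 0 by rewrite -unitfE (valP w).
set S := LHS; pose t : F := val w ^+ a * (val w)^-1 ^+ b.
have neq_t1 : t != 1.
  apply: contraNneq neq_ab => t1; rewrite -ord_w -eq_expg_mod_order.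
  apply/eqP/val_inj; rewrite !FinRing.val_unitX.
  apply: (mulIf (x := (val w)^-1 ^+ b)); first by rewrite expf_neq0 ?invr_eq0.
  by rewrite [LHS]t1 exprVn divff ?expf_neq0.
have : S = t * S.
  rewrite {1}/S (reindex_inj (mulfI w_neq0)) mulr_sumr /=; apply: eq_big => x.
    by rewrite mulf_eq0 negb_or w_neq0.
  by move=> _; rewrite invfM !exprMn mulrACA.
move/eqP; rewrite -subr_eq0 -{1}(mul1r S) -mulrBl mulf_eq0 subr_eq0 eq_sym.
by rewrite (negPf neq_t1) => /eqP ->; rewrite oppr0.
Qed.

(** The [p^s]-power map shifts the terms by one, cyclically because [x^(p^N) = x]. *)
Lemma relTr_exp (F : finFieldType) (p N s : nat) (x : F) :
  prime p -> #|F| = (p ^ N)%N -> (0 < s)%N -> (s %| N)%N ->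
  relTr p N s x ^+ (p ^ s) = relTr p N s x.
Proof.
move=> p_prime cardF s_gt0 /dvdnP[M eqN].
have pcharF := card_finPcharP cardF p_prime.
have pnat_ps : [pchar F].-nat (p ^ s)%N.
  by rewrite (eq_pnat _ (pcharf_eq pcharF)) pnatX pnat_id.
have expD : {morph (fun y : F => y ^+ (p ^ s)) : y z / y + z}.
  by move=> y z; apply: exprDn_pchar.
rewrite /relTr (big_morph _ expD (id1 := 0)); last first.
  by rewrite expr0n expn_eq0 -leqn0 leqNgt prime_gt0.
rewrite eqN mulnK //.
have telescope : \sum_(0 <= i < M) (x ^+ (p ^ (i.+1 * s)) - x ^+ (p ^ (i * s))) = 0.
  rewrite (telescope_sumr (fun i => x ^+ (p ^ (i * s)))) // -eqN -cardF expf_card.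
  by rewrite mul0n expn0 expr1 subrr.
apply/eqP; rewrite -subr_eq0 -sumrB; apply/eqP; rewrite -[RHS]telescope big_mkord.
by apply: eq_bigr => i _; rewrite -exprM -expnD mulSn addnC.
Qed.

(** The nonzero element [Tr x - 1] is fixed by the [p^s]-power map, so one factor cancels. *)
Lemma relTr_indicator (F : finFieldType) (p N s : nat) (x : F) :
  prime p -> #|F| = (p ^ N)%N -> (0 < s)%N -> (s %| N)%N ->
  relTr p N s x != 1 -> (relTr p N s x - 1) ^+ (p ^ s).-1 = 1.
Proof.
move=> p_prime cardF s_gt0 dvd_s; rewrite -subr_eq0 => z_neq0.
have pcharF := card_finPcharP cardF p_prime.
have pnat_ps : [pchar F].-nat (p ^ s)%N.
  by rewrite (eq_pnat _ (pcharf_eq pcharF)) pnatX pnat_id.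
apply: (mulfI z_neq0); rewrite mulr1 -exprS prednK ?expn_gt0 ?prime_gt0 //.
by rewrite exprDn_pchar // exprNn_pchar // expr1n relTr_exp.
Qed.

(** * Isolating a single monomial *)

Lemma sum_full_digits (p N s : nat) (d : nat -> nat) :
  (0 < s)%N -> full_digits p N s d -> (\sum_(0 <= l < N) d l = s * p.-1)%N.
Proof.
move=> s_gt0 full_d; rewrite big_mkord.
rewrite (partition_big (fun l : 'I_N => Ordinal (ltn_pmod l s_gt0)) xpredT) //=.
rewrite -[s in RHS]card_ord -sum_nat_const; apply: eq_bigr => j _.
by rewrite -(full_d j) // big_mkord.
Qed.

(** Entries of [m] may reach [p] or more, so distinct [m] can share a value. *)
Definition digits_val (p N : nat) (m : 'X_{1..N}) : nat := (\sum_(l < N) m l * p ^ l)%N.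

Lemma meval_frobenius (F : fieldType) (p N : nat) (q : {mpoly F[N]}) (x : F) :
  q.@[fun l => x ^+ (p ^ l)] = \sum_(m <- msupp q) q@_m * x ^+ digits_val p N m.
Proof.
rewrite mevalE; apply: eq_bigr => m _; congr (_ * _); rewrite -prodrXr.
by apply: eq_bigr => l _; rewrite -exprM mulnC.
Qed.

Lemma multinom_rigid_unique (p N : nat) (d d' : nat -> nat) (m m' : 'X_{1..N}) :
  (1 < p)%N ->
  carry_rigid p N (fun i => (d i)%:Z - (d' i)%:Z) ->
  (forall i, d i = 0%N \/ d' i = 0%N) ->
  let D := [multinom d i | i < N] in let D' := [multinom d' i | i < N] in
  (mdeg m <= mdeg D)%N -> (mdeg m' <= mdeg D')%N ->
  (digits_val p N m + digits_val p N D' = digits_val p N m' + digits_val p N D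
     %[mod (p ^ N).-1])%N ->
  m = D /\ m' = D'.
Proof.
(* The case [N = 0] is set apart because [inord] needs a nonempty index type. *)
case: N m m' => [|N] m m' p_gt1 rigid disj D D'.
  by move=> _ _ _; split; apply/mnmP => -[].
pose u (q : 'X_{1..N.+1}) i := q (inord i).
have uE q (f : nat -> nat) : (\sum_(0 <= i < N.+1) u q i * f i = \sum_(l < N.+1) q l * f l)%N.
  by rewrite big_mkord; apply: eq_bigr => l _; rewrite /u inord_val.
have uD (e f : nat -> nat) :
    (\sum_(l < N.+1) [multinom e i | i < N.+1] l * f l =
     \sum_(0 <= i < N.+1) e i * f i)%N.
  by rewrite big_mkord; apply: eq_bigr => l _; rewrite mnmE.
have mass q : (mdeg q = \sum_(l < N.+1) q l * 1)%N.
  by rewrite mdegE; apply: eq_bigr => l _; rewrite muln1.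
have sum1 (f : nat -> nat) : (\sum_(0 <= i < N.+1) f i * 1 = \sum_(0 <= i < N.+1) f i)%N.
  by apply: eq_bigr => i _; rewrite muln1.
rewrite !mass /digits_val /D /D' !(uD _ (fun=> 1%N)) !(uD _ (fun l => p ^ l)%N).
rewrite -!(uE _ (fun=> 1%N)) -!(uE _ (fun l => p ^ l)%N) !sum1 => le_m le_m' cong.
have eq_u := carry_rigid_unique _ _ _ _ _ _ p_gt1 rigid disj le_m le_m' cong.
by split; apply/mnmP => l; have [] := eq_u l (ltn_ord l); rewrite /u inord_val mnmE.
Qed.

Lemma exists_trace_pair (F : finFieldType) (p N s s' : nat) (alpha : F) :
  prime p -> #|F| = (p ^ N)%N -> (0 < s)%N -> (s %| N)%N -> (0 < s')%N -> (s' %| N)%N ->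
  alpha != 0 -> (2 * (s + s' + 1) <= N)%N ->
  exists x, [/\ x != 0, relTr p N s x = 1 & relTr p N s' (alpha * x^-1) = 1].
Proof.
move=> p_prime cardF s_gt0 dvd_s s'_gt0 dvd_s' alpha_neq0 le_N.
have p_gt1 := prime_gt1 p_prime; have pcharF := card_finPcharP cardF p_prime.
have [/existsP[x /and3P[x_neq0 /eqP Tx /eqP T'x]]|/existsPn none] :=
  boolP [exists x : F, [&& x != 0, relTr p N s x == 1 & relTr p N s' (alpha * x^-1) == 1]].
  by exists x.
have [d [d' [full_d full_d' disj rigid]]] := exists_rigid_digits p N s s' p_prime s_gt0 le_N.
(* Evaluated at the powers [x^(p^l)], this vanishes unless the trace of [x] is [1]. *)
pose poly t : {mpoly F[N]} := 1 - class_forms F N t (fun _ => p.-1).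
pose D := [multinom d i | i < N]; pose D' := [multinom d' i | i < N].
have mdeg_full t e : (0 < t)%N -> full_digits p N t e ->
    mdeg [multinom e i | i < N] = (t * p.-1)%N.
  move=> t_gt0 /sum_full_digits <- //; rewrite mdegE big_mkord.
  by apply: eq_bigr => l _; rewrite mnmE.
have coef_full t e : (0 < t)%N -> full_digits p N t e ->
    (poly t)@_[multinom e i | i < N] != 0.
  move=> t_gt0 full_e; rewrite /poly mcoeffB mcoeff1.
  (* The multinomial has positive degree, so the constant [1] does not affect this coefficient. *)
  rewrite -mdeg_eq0 (mdeg_full t) // muln_eq0 !gtn_eqF //; last by lia.
  rewrite sub0r oppr_eq0; apply: (mcoeff_class_forms_neq0 _ p) => // [_|j].
    by rewrite ltn_predL prime_gt0.
  by rewrite -(full_e j) // big_mkord; apply: eq_bigr => l _; rewrite mnmE.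
have mdeg_poly t m : m \in msupp (poly t) -> (mdeg m <= t * p.-1)%N.
  move=> /msuppB_le; rewrite mem_cat msupp1 inE => /orP[/eqP->|]; first by rewrite mdeg0.
  by move=> /mdeg_msupp_class_forms; rewrite sum_nat_const card_ord.
have evalE t x : (t %| N)%N ->
    (poly t).@[fun l => x ^+ (p ^ l)] = 1 - (relTr p N t x - 1) ^+ (p ^ t).-1.
  by move=> dvd_t; rewrite mevalB meval1 meval_class_forms.
pose E := digits_val p N D; pose E' := digits_val p N D'.
pose val x := (poly s).@[fun l => x ^+ (p ^ l)] *
  (poly s').@[fun l => (alpha * x^-1) ^+ (p ^ l)].
have val0 x : x != 0 -> val x = 0.
  move=> x_neq0; have := none x; rewrite x_neq0 /= negb_and /val !evalE //.
  have ind := relTr_indicator _ _ _ _ _ p_prime cardF.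
  case/orP => [/(ind _ _ s_gt0 dvd_s)|/(ind _ _ s'_gt0 dvd_s')] ->.
    by rewrite subrr mul0r.
  by rewrite subrr mulr0.
(* The factor [x^(E' - E)] cancels the power of [x] belonging to the pair [(D, D')]; by rigidity no
   other pair survives the summation. *)
have : \sum_(x : F | x != 0) val x * (x ^+ E' * x^-1 ^+ E) = 0.
  by rewrite big1 // => x /val0 ->; rewrite mul0r.
suff -> : \sum_(x : F | x != 0) val x * (x ^+ E' * x^-1 ^+ E) =
    - ((poly s)@_D * (poly s')@_D' * alpha ^+ E').
  move/eqP; rewrite oppr_eq0 !mulf_eq0 expf_eq0 (negPf alpha_neq0) andbF orbF.
  by rewrite (negPf (coef_full _ _ _ full_d)) // (negPf (coef_full _ _ _ full_d')).
transitivity (\sum_(m <- msupp (poly s)) \sum_(m' <- msupp (poly s'))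
    (poly s)@_m * (poly s')@_m' * alpha ^+ digits_val p N m' *
    \sum_(x : F | x != 0) x ^+ (digits_val p N m + E') *
      x^-1 ^+ (digits_val p N m' + E)).
  under eq_bigr => x _ do rewrite /val !meval_frobenius mulr_suml mulr_suml.
  rewrite exchange_big /=; apply: eq_bigr => m _.
  under eq_bigr => x _ do rewrite mulr_sumr mulr_suml.
  rewrite exchange_big /=; apply: eq_bigr => m' _.
  rewrite mulr_sumr; apply: eq_bigr => x _.
  have regroup (a b c e f g h : F) : a * b * (c * (e * f)) * (g * h) =
      a * c * e * (b * g * (f * h)) by ring.
  by rewrite !exprD exprMn regroup.
have memD : D \in msupp (poly s) by rewrite mcoeff_msupp coef_full.
have memD' : D' \in msupp (poly s') by rewrite mcoeff_msupp coef_full.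
have zero m m' : m \in msupp (poly s) -> m' \in msupp (poly s') ->
    (m, m') != (D, D') ->
    \sum_(x : F | x != 0) x ^+ (digits_val p N m + E') *
      x^-1 ^+ (digits_val p N m' + E) = 0.
  move=> /mdeg_poly le_m /mdeg_poly le_m' neq; rewrite sum_unit_monomial cardF.
  case: eqP => [cong|]; last by rewrite oppr0.
  case/negP: neq; rewrite -(mdeg_full _ _ s_gt0 full_d) in le_m.
  rewrite -(mdeg_full _ _ s'_gt0 full_d') in le_m'.
  by have [-> ->] := multinom_rigid_unique _ _ _ _ _ _ p_gt1 rigid disj le_m le_m' cong.
rewrite (bigD1_seq D) ?msupp_uniq //= [X in _ + X]big1_seq ?addr0; last first.
  move=> m /andP[neq mem]; rewrite big1_seq // => m' /andP[_ mem'].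
  by rewrite zero ?mulr0 // xpair_eqE (negPf neq).
rewrite (bigD1_seq D') ?msupp_uniq //= [X in _ + X]big1_seq ?addr0; last first.
  move=> m' /andP[neq mem]; rewrite zero ?mulr0 //.
  by rewrite xpair_eqE eqxx.
by rewrite sum_unit_monomial addnC eqxx mulrN1.
Qed.

(** * From prime [p] to prime powers, and back to points of the line *)

Lemma relTr_expn (F : fieldType) (p k n r : nat) (x : F) :
  (0 < k)%N -> relTr (p ^ k) n r x = relTr p (k * n) (k * r) x.
Proof.
move=> k_gt0; rewrite /relTr divnMl //; apply: eq_bigr => i _.
by rewrite -expnM mulnCA.
Qed.

Theorem theorem3p5 (F : finFieldType) (q n r1 r2 : nat) (alpha : F) :
  prime_power q -> #|F| = (q ^ n)%N -> (2 <= n)%N ->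
  (0 < r1)%N -> (r1 %| n)%N -> (0 < r2)%N -> (r2 %| n)%N ->
  alpha != 0 ->
  (2 * (r1 + r2 + 1) <= n)%N ->
  exists P : F * F, L_set q n r1 P /\ sigmaL_set q n r2 alpha P.
Proof.
move=> [p [k [p_prime k_gt0 ->]]] cardF _ r1_gt0 dvd_r1 r2_gt0 dvd_r2 alpha_neq0 le_n.
rewrite -expnM in cardF.
(* The bound survives scaling by [k] because [1 <= k]. *)
have le_kn : (2 * (k * r1 + k * r2 + 1) <= k * n)%N.
  by rewrite (leq_trans _ (leq_mul (leqnn k) le_n)) //; nia.
have kr1_gt0 : (0 < k * r1)%N by rewrite muln_gt0 k_gt0.
have kr2_gt0 : (0 < k * r2)%N by rewrite muln_gt0 k_gt0.
have [x [x_neq0 T1 T2]] := exists_trace_pair F p _ _ _ alpha p_prime cardF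
  kr1_gt0 (dvdn_mul (dvdnn k) dvd_r1) kr2_gt0 (dvdn_mul (dvdnn k) dvd_r2) alpha_neq0 le_kn.
have y_neq0 : alpha * x^-1 != 0 by rewrite mulf_neq0 ?invr_eq0.
(* With [y = alpha / x], both traces are [1], and [(alpha, y)] is [alpha / x] times [(x, 1)]. *)
exists (x, 1); split.
  exists x; rewrite // relTr_expn // T1.
  by exists 1; rewrite ?oner_neq0 // !mul1r.
exists (alpha * x^-1); rewrite // relTr_expn // T2 mulr1.
exists (x * alpha^-1); first by rewrite mulf_neq0 ?invr_eq0.
by rewrite /= divfK // mulrA divfK // divff.
Qed.
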